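(* Let $y(z/q),y(z),y(qz)$ be the unknowns in the linear $q$-difference equation $L_1y(z)=0$, where $L_1=L_1(f,g)$ is the $D_5^{(1)}$ operator defined in the context. For each blow-up coordinate system below, restrict $L_1y(z)=0$ to the exceptional line (that is, take the coefficientwise limit, after division by a common factor if needed, as explained in the context). The resulting equation is, up to multiplication by a nonzero function, the $q$-Heun equation $$(x-h_1q^{1/2})(x-h_2q^{1/2})\,w(x/q)+l_3l_4(x-l_1q^{-1/2})(x-l_2q^{-1/2})\,w(qx)-\{(l_3+l_4)x^2+Ex+(l_1l_2l_3l_4h_1h_2)^{1/2}(h_3^{1/2}+h_3^{-1/2})\}\,w(x)=0$$ with $x=z$ (for an appropriate overall sign of the square-root constant term), with the following $w$, parameters and accessory parameter $E$. (1) Point $P_5=(0,\nu_5/\kappa_2)$: $(f,g)=(f_1,\,f_1g_1+\nu_5/\kappa_2)$, line $f_1=0$. Then $w(z)=y(z)$, $h_1=q^{1/2}\nu_3$, $h_2=q^{1/2}\nu_4$, $h_3=q\nu_5/\nu_6$, $l_1=q^{1/2}\kappa_1/\nu_7$, $l_2=q^{1/2}\kappa_1/\nu_8$, $l_3=1/\nu_1$, $l_4=1/\nu_2$, and $$E=q g_1\nu_3\nu_4\Bigl(1-\frac{\nu_6}{\nu_5}\Bigr)-\frac{q\nu_5(\nu_3+\nu_4)}{\kappa_2}-\frac{\kappa_1\kappa_2(\nu_7+\nu_8)}{\nu_1\nu_2\nu_5\nu_7\nu_8}.$$ (2) Point $P_7=(\kappa_1/\nu_7,0)$: $(f,g)=(f_1g_1+\kappa_1/\nu_7,\,g_1)$,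 line $g_1=0$. Then $w(z)=y(z)/(\nu_7z-\kappa_1)$, $h_1=q^{1/2}\nu_3$, $h_2=q^{1/2}\nu_4$, $h_3=\nu_6/\nu_5$, $l_1=\kappa_1/(q^{1/2}\nu_7)$, $l_2=q^{1/2}\kappa_1/\nu_8$, $l_3=q/\nu_1$, $l_4=q/\nu_2$, and $$E=\frac{qf_1}{\nu_1\nu_2}\Bigl(1-\frac{\nu_7}{\nu_8}\Bigr)-\frac{q\kappa_1}{\nu_7}\Bigl(\frac1{\nu_1}+\frac1{\nu_2}\Bigr)-\frac{q^2\nu_3\nu_4\nu_7(\nu_5+\nu_6)}{\kappa_1\kappa_2}.$$ (3) Point $P_1=(\infty,1/\nu_1)$: $(f,g)=(1/f_1,\,f_1g_1+1/\nu_1)$, line $f_1=0$. Then $w(z)=y(z)$, $h_1=q^{1/2}\nu_3$, $h_2=q^{1/2}\nu_4$, $h_3=\nu_6/\nu_5$, $l_1=q^{1/2}\kappa_1/\nu_7$, $l_2=q^{1/2}\kappa_1/\nu_8$, $l_3=1/\nu_1$, $l_4=q/\nu_2$, and $$E=qg_1\Bigl(1-\frac{\nu_1}{\nu_2}\Bigr)-\frac{q}{\nu_1}(\nu_3+\nu_4)-\frac{q\kappa_1}{\nu_2}\Bigl(\frac1{\nu_7}+\frac1{\nu_8}\Bigr).$$ (4) Point $P_3=(\nu_3,\infty)$: $(f,g)=(f_1g_1+\nu_3,\,1/g_1)$, line $g_1=0$. Then $w(z)=y(z)/(z-q\nu_3)$, $h_1=q^{3/2}\nu_3$, $h_2=q^{1/2}\nu_4$,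 $h_3=\nu_6/\nu_5$, $l_1=q^{1/2}\kappa_1/\nu_7$, $l_2=q^{1/2}\kappa_1/\nu_8$, $l_3=q/\nu_1$, $l_4=q/\nu_2$, and $$E=q^2\Bigl\{f_1\Bigl(1-\frac{\nu_4}{\nu_3}\Bigr)-\nu_3\Bigl(\frac1{\nu_1}+\frac1{\nu_2}\Bigr)-\frac{\nu_4}{\kappa_2}(\nu_5+\nu_6)\Bigr\}.$$ For the points $P_6=(0,\nu_6/\kappa_2)$, $P_8=(\kappa_1/\nu_8,0)$, $P_2=(\infty,1/\nu_2)$, $P_4=(\nu_4,\infty)$ the same statements hold with, respectively, $\nu_5\leftrightarrow\nu_6$, $\nu_7\leftrightarrow\nu_8$, $\nu_1\leftrightarrow\nu_2$, $\nu_3\leftrightarrow\nu_4$ exchanged in (1), (2), (3), (4).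
   Context: $q,\kappa_1,\kappa_2,\nu_1,\dots,\nu_8$ are non-zero complex parameters with $\kappa_1^2\kappa_2^2=q\,\nu_1\nu_2\cdots\nu_8$. $T_z$ is the shift $T_zy(z)=y(qz)$, $T_z^{-1}y(z)=y(z/q)$. The operator $L_1$ (one member of the Lax pair of the $q$-Painlevé equation of type $D_5^{(1)}$; $f,g$ are its dependent variables) is $$L_1=\Bigl\{\frac{z(g\nu_1-1)(g\nu_2-1)}{qg}-\frac{\nu_1\nu_2\nu_3\nu_4(g-\nu_5/\kappa_2)(g-\nu_6/\kappa_2)}{fg}\Bigr\}+\frac{\nu_1\nu_2(z-q\nu_3)(z-q\nu_4)}{q(qf-z)}(g-T_z^{-1})+\frac{(z-\kappa_1/\nu_7)(z-\kappa_1/\nu_8)}{q(f-z)}\Bigl(\frac1g-T_z\Bigr).$$ The space of initial values of the $q$-Painlevé equation of type $D_5^{(1)}$ is $\mathbb P^1\times\mathbb P^1$ (coordinates $(f,g)$) blown up at the eight points $P_1,\dots,P_8$: $(\infty,1/\nu_i)_{i=1,2}$, $(\nu_i,\infty)_{i=3,4}$, $(0,\nu_i/\kappa_2)_{i=5,6}$, $(\kappa_1/\nu_i,0)_{i=7,8}$. Each coordinate system $(f_1,g_1)$ in the claim is a chart of the blow-up at the indicated point, the indicated line being the exceptional curve. Restricting $L_1y(z)=0$ to the exceptional line means: substitute the given expressions for $f,g$ into $L_1$, write the equation as $a\,y(z/q)+b\,y(z)+c\,y(qz)=0$ with $a,b,c$ rational in $z,f_1,g_1$; then set the coordinate vanishing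 on the line to $0$ by taking limits of $a,b,c$ (in case (3), after first dividing $a,b,c$ by the common factor $f_1$). The remaining coordinate on the line is kept as a free parameter. Parameter $E$ is called the accessory parameter of the $q$-Heun equation. ''Appropriate overall sign'' means: $(l_1l_2l_3l_4h_1h_2)^{1/2}(h_3^{1/2}+h_3^{-1/2})$ is evaluated with mutually inverse values $h_3^{1/2},h_3^{-1/2}$ and one of the two possible overall signs of the whole product. *)

(* Defs.v *)
From HB Require Import structures.
From mathcomp Require Import all_boot all_order all_algebra.
From mathcomp Require Import complex.
From mathcomp Require Import classical_sets reals topology normedtype.

Set Implicit Arguments.
Unset Strict Implicit.
Unset Printing Implicit Defensive.

Import Order.TTheory GRing.Theory Num.Theory.
Import numFieldNormedType.Exports.

Local Open Scope classical_set_scope.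
Local Open Scope ring_scope.

(* The left-hand side of a three-term linear q-difference equation
   a(z) y(z/q) + b(z) y(z) + c(z) y(qz) = 0, as a function of z and of the
   values ym, y0, yp of y(z/q), y(z), y(qz).  These values are independent
   unknowns, so that the coefficients a, b, c are well defined even when q is a
   root of unity. *)
Definition qform (C : Type) := C -> C -> C -> C -> C.

Definition coefm (C : nzRingType) (L : qform C) (z : C) := L z 1 0 0.
Definition coef0 (C : nzRingType) (L : qform C) (z : C) := L z 0 1 0.
Definition coefp (C : nzRingType) (L : qform C) (z : C) := L z 0 0 1.

Definition L1 (C : fieldType) (q k1 k2 nu1 nu2 nu3 nu4 nu5 nu6 nu7 nu8 : C)
    (f g : C) : qform C := fun z ym y0 yp =>
  (z * (g * nu1 - 1) * (g * nu2 - 1) / (q * g)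
    - nu1 * nu2 * nu3 * nu4 * (g - nu5 / k2) * (g - nu6 / k2) / (f * g)) * y0
  + nu1 * nu2 * (z - q * nu3) * (z - q * nu4) / (q * (q * f - z))
      * (g * y0 - ym)
  + (z - k1 / nu7) * (z - k1 / nu8) / (q * (f - z)) * (1 / g * y0 - yp).

Record qHeunParams (C : Type) := QHeunParams {
  h1 : C; h2 : C; h3 : C; l1 : C; l2 : C; l3 : C; l4 : C
}.

(* qh is a chosen value of q^(1/2).  sgn selects the overall sign of the
   constant term; sqrtC is a fixed branch of the complex square root. *)
Definition qHeun (C : numClosedFieldType) (qh : C) (p : qHeunParams C)
    (E : C) (sgn : bool) : qform C := fun x wm w0 wp =>
  let k := (-1) ^+ sgn
           * (sqrtC (l1 p * l2 p * l3 p * l4 p * h1 p * h2 p)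
              * (sqrtC (h3 p) + (sqrtC (h3 p))^-1)) in
  (x - h1 p * qh) * (x - h2 p * qh) * wm
  + l3 p * l4 p * (x - l1 p * qh^-1) * (x - l2 p * qh^-1) * wp
  - ((l3 p + l4 p) * x ^+ 2 + E * x + k) * w0.

(* Identities between rational functions of z are stated off a finite set,
   which contains the zeros of the denominators (where x / 0 = 0). *)
Definition generically (C : eqType) (P : C -> Prop) : Prop :=
  exists S : seq C, forall z, z \notin S -> P z.

(* a, b, c are the coefficients of the limit of the family L t as t -> 0. *)
Definition has_limit_coefs (C : numFieldType) (L : C -> qform C)
    (a b c : C -> C) : Prop :=
  generically (fun z : C =>
    [/\ coefm (L t) z @[t --> 0^'] --> a z,
        coef0 (L t) z @[t --> 0^'] --> b z
      & coefp (L t) z @[t --> 0^'] --> c z]).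

(* The limit of the family L t as t -> 0 is, up to multiplication by a nonzero
   function lam of z, the equation M for w = y / phi. *)
Definition restricts_to (C : numFieldType) (q : C) (L : C -> qform C)
    (phi : C -> C) (M : qform C) : Prop :=
  exists a b c : C -> C, has_limit_coefs L a b c /\
  exists lam : C -> C, generically (fun z =>
    lam z != 0 /\
    forall ym y0 yp : C,
      a z * ym + b z * y0 + c z * yp
      = lam z * M z (ym / phi (z / q)) (y0 / phi z) (yp / phi (q * z))).

(* Main.v *)
Require Import Defs.
From HB Require Import structures.
From mathcomp Require Import all_boot all_order all_algebra.
From mathcomp Require Import complex.
From mathcomp Require Import classical_sets reals topology normedtype.
From mathcomp Require Import boolp ring.
Import Order.TTheory GRing.Theory Num.Theory.
Import numFieldNormedType.Exports.
Local Open Scope ring_scope.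
Local Open Scope complex_scope.

(** Near each exceptional line the coefficients of [L1] are rational functions
    of the coordinate that vanishes on the line, and the pole (or the factor
    common to the three coefficients) cancels explicitly; for P3 and P7 the
    coefficient of [y(z)] has several terms with a simple pole whose residues
    add up to 0, by the relation between the parameters in the case of P7.  What
    remains is continuous at the line, and its value there is compared with the
    q-Heun equation.  The square-root constant term enters only through its
    square, so that each limit equation is matched with an explicit constant
    [K] whose square is [l1 l2 l3 l4 h1 h2 (h3 + 2 + 1 / h3)]; as [K] does not
    involve the free coordinate of the line, neither does the sign. *)

(** * The sign of the square-root constant term *)

Lemma qHeun_sign (C : numClosedFieldType) (qh : C) (p : qHeunParams C) (K : C) :
  h3 p != 0 ->
  K ^+ 2 = l1 p * l2 p * l3 p * l4 p * h1 p * h2 p * (h3 p + 2 + (h3 p)^-1) ->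
  exists sgn : bool, forall E x wm w0 wp : C,
    qHeun qh p E sgn x wm w0 wp =
      (x - h1 p * qh) * (x - h2 p * qh) * wm
      + l3 p * l4 p * (x - l1 p * qh^-1) * (x - l2 p * qh^-1) * wp
      - ((l3 p + l4 p) * x ^+ 2 + E * x + K) * w0.
Proof.
move=> h3_neq0 hK; rewrite /qHeun.
set P := l1 p * _ * _ * _ * _ * _ in hK *.
set k := sqrtC P * _.
have s_neq0 : sqrtC (h3 p) != 0 by rewrite sqrtC_eq0.
have : K ^+ 2 == k ^+ 2.
  apply/eqP; rewrite hK /k exprMn sqrtCK; congr (_ * _).
  (* With [s = sqrtC (h3 p)] this becomes [s^2 + 2 + s^-2 = (s + s^-1)^2]. *)
  rewrite -[in LHS](sqrtCK (h3 p)).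
  by field.
rewrite eqf_sqr => /orP[] /eqP ->.
  by exists false => *; rewrite expr0 mul1r.
by exists true => *; rewrite expr1 mulN1r.
Qed.

(** * Limits at a removable singularity *)

Section Limits.
Local Open Scope classical_set_scope.
Context {C : numFieldType}.
Implicit Types F G D : C -> C.

Definition cont0 F := F t @[t --> 0] --> F 0.

Lemma cont0_cst (c : C) : cont0 (fun=> c).
Proof. exact: (@cvg_cst _ _ _ (nbhs (0 : C))). Qed.

Lemma cont0_id : cont0 id.
Proof. exact: (@cvg_id _ (nbhs (0 : C))). Qed.

Lemma cont0D F G : cont0 F -> cont0 G -> cont0 (fun t => F t + G t).
Proof. by move=> contF contG; exact: (cvgD contF contG). Qed.

Lemma cont0N F : cont0 F -> cont0 (fun t => - F t).
Proof. by move=> contF; exact: (cvgN contF). Qed.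

Lemma cont0M F G : cont0 F -> cont0 G -> cont0 (fun t => F t * G t).
Proof. by move=> contF contG; exact: (cvgM contF contG). Qed.

Lemma cont0V F : cont0 F -> F 0 != 0 -> cont0 (fun t => (F t)^-1).
Proof. by move=> contF F0; exact: (cvgV F0 contF). Qed.

(** By continuity [D] has no zero near 0, so [F] and [G] agree on a punctured neighbourhood of 0 and
    [F] inherits the limit of [G]. *)
Lemma cvg_removable F G D :
    cont0 G -> cont0 D -> D 0 != 0 ->
    (forall t, t != 0 -> D t != 0 -> F t = G t) ->
  F t @[t --> 0^'] --> G 0.
Proof.
move=> contG contD D0 FG.
have contG' : G t @[t --> 0^'] --> G 0 by exact: cvg_within_filter.
have D_neq0 : \forall t \near 0^', D t != 0.
  exact/nbhs_dnbhs/(cvgr_neq0 _ contD).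
apply: cvg_trans contG'; apply: near_eq_cvg; near=> t.
by apply/esym/FG; near: t; [exact: nbhs_dnbhs_neq | exact: D_neq0].
Unshelve. all: by end_near. Qed.

End Limits.

(** Constants are tried first, so the only goals left over are the nonvanishing at 0 of the
    denominators that depend on [t]. *)
Ltac cont0_tac :=
  lazymatch goal with
  | |- cont0 (fun=> ?c) => apply: cont0_cst
  | |- cont0 (fun t => t) => apply: cont0_id
  | |- cont0 (fun t => @GRing.add _ (@?a t) (@?b t)) =>
      apply: (@cont0D _ a b); cont0_tac
  | |- cont0 (fun t => @GRing.opp _ (@?a t)) =>
      apply: (@cont0N _ a); cont0_tac
  | |- cont0 (fun t => @GRing.mul _ (@?a t) (@?b t)) =>
      apply: (@cont0M _ a b); cont0_tac
  | |- cont0 (fun t => @GRing.inv _ (@?a t)) =>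
      apply: (@cont0V _ a); [cont0_tac | cbv beta]
  end.

(* [Gm], [G0], [Gp] are the coefficients of [L] after the cancellation; their
   second argument is the coordinate vanishing on the line, and [D] is a common
   denominator off which the cancellation is valid. *)
Lemma restricts_to_regular (C : numFieldType) (q : C) (L : C -> qform C)
    (phi : C -> C) (M : qform C) (S : seq C) (Gm G0 Gp D : C -> C -> C)
    (lam : C -> C) :
    (forall z, z \notin S ->
      [/\ cont0 (Gm z), cont0 (G0 z), cont0 (Gp z), cont0 (D z)
        & D z 0 != 0]) ->
    (forall z t : C, z \notin S -> t != 0 -> D z t != 0 ->
      [/\ coefm (L t) z = Gm z t, Defs.coef0 (L t) z = G0 z t
        & Defs.coefp (L t) z = Gp z t]) ->
    (forall z, z \notin S -> lam z != 0 /\ forall ym y0 yp : C,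
      Gm z 0 * ym + G0 z 0 * y0 + Gp z 0 * yp
      = lam z * M z (ym / phi (z / q)) (y0 / phi z) (yp / phi (q * z))) ->
  restricts_to q L phi M.
Proof.
move=> cont LG GM.
exists (Gm^~ 0), (G0^~ 0), (Gp^~ 0); split; last first.
  by exists lam, S => z /GM.
exists S => z zS; have [contm contG0 contp contD D_neq0] := cont z zS.
by split; [apply: (@cvg_removable _ _ _ (D z) contm contD D_neq0)
          |apply: (@cvg_removable _ _ _ (D z) contG0 contD D_neq0)
          |apply: (@cvg_removable _ _ _ (D z) contp contD D_neq0)] => t t0 Dt;
  have [] := LG z t zS t0 Dt.
Qed.

(** * Symmetries of [L1], which yield P2, P4, P6 and P8 from P1, P3, P5 and P7 *)

Lemma L1_swap12 (C : fieldType) (q k1 k2 nu1 nu2 nu3 nu4 nu5 nu6 nu7 nu8 : C) :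
  L1 q k1 k2 nu2 nu1 nu3 nu4 nu5 nu6 nu7 nu8
  = L1 q k1 k2 nu1 nu2 nu3 nu4 nu5 nu6 nu7 nu8.
Proof.
by apply/funext => f; apply/funext => g; do 4 apply/funext => ?; rewrite /L1; ring.
Qed.

Lemma L1_swap34 (C : fieldType) (q k1 k2 nu1 nu2 nu3 nu4 nu5 nu6 nu7 nu8 : C) :
  L1 q k1 k2 nu1 nu2 nu4 nu3 nu5 nu6 nu7 nu8
  = L1 q k1 k2 nu1 nu2 nu3 nu4 nu5 nu6 nu7 nu8.
Proof.
by apply/funext => f; apply/funext => g; do 4 apply/funext => ?; rewrite /L1; ring.
Qed.

Lemma L1_swap56 (C : fieldType) (q k1 k2 nu1 nu2 nu3 nu4 nu5 nu6 nu7 nu8 : C) :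
  L1 q k1 k2 nu1 nu2 nu3 nu4 nu6 nu5 nu7 nu8
  = L1 q k1 k2 nu1 nu2 nu3 nu4 nu5 nu6 nu7 nu8.
Proof.
by apply/funext => f; apply/funext => g; do 4 apply/funext => ?; rewrite /L1; ring.
Qed.

Lemma L1_swap78 (C : fieldType) (q k1 k2 nu1 nu2 nu3 nu4 nu5 nu6 nu7 nu8 : C) :
  L1 q k1 k2 nu1 nu2 nu3 nu4 nu5 nu6 nu8 nu7
  = L1 q k1 k2 nu1 nu2 nu3 nu4 nu5 nu6 nu7 nu8.
Proof.
by apply/funext => f; apply/funext => g; do 4 apply/funext => ?; rewrite /L1; ring.
Qed.

(** * The exceptional lines over P5, P1, P7 and P3 *)

Section ExceptionalLines.
Context {C : numClosedFieldType}.
Context (q qh k1 k2 nu1 nu2 nu3 nu4 nu5 nu6 nu7 nu8 : C).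
Context (hq : q != 0) (hk1 : k1 != 0) (hk2 : k2 != 0)
    (hnu1 : nu1 != 0) (hnu2 : nu2 != 0) (hnu3 : nu3 != 0) (hnu4 : nu4 != 0)
    (hnu5 : nu5 != 0) (hnu6 : nu6 != 0) (hnu7 : nu7 != 0) (hnu8 : nu8 != 0).
Context (hrel : k1 ^+ 2 * k2 ^+ 2
            = q * (nu1 * nu2 * nu3 * nu4 * nu5 * nu6 * nu7 * nu8)).
Context (hqh : qh ^+ 2 = q).
Let L := L1 q k1 k2 nu1 nu2 nu3 nu4 nu5 nu6 nu7 nu8.

Let qh_neq0 : qh != 0.
Proof. by have := hq; rewrite -hqh sqrf_eq0. Qed.

(** Eliminating [nu8] by this, and [q] as [qh ^+ 2], leaves independent parameters, so that [field]
    can decide the comparisons with the q-Heun equation. *)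
Let nu8E :
  nu8 = k1 ^+ 2 * k2 ^+ 2 / (q * (nu1 * nu2 * nu3 * nu4 * nu5 * nu6 * nu7)).
Proof. by rewrite hrel; field; do ![apply/andP; split]. Qed.

Lemma restricts_to_P5 : exists sgn : bool, forall g1 : C,
  restricts_to q
    (fun f1 => L f1 (f1 * g1 + nu5 / k2))
    (fun=> 1)
    (qHeun qh
      {| h1 := qh * nu3; h2 := qh * nu4; h3 := q * nu5 / nu6;
         l1 := qh * k1 / nu7; l2 := qh * k1 / nu8;
         l3 := 1 / nu1; l4 := 1 / nu2 |}
      (q * g1 * nu3 * nu4 * (1 - nu6 / nu5)
       - q * nu5 * (nu3 + nu4) / k2
       - k1 * k2 * (nu7 + nu8) / (nu1 * nu2 * nu5 * nu7 * nu8))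
      sgn).
Proof.
set p := QHeunParams _ _ _ _ _ _ _.
(* By [hrel], [l1 l2 l3 l4 h1 h2 = q^3 nu3^2 nu4^2 nu5 nu6 / k2^2], and [h3 + 2 + 1 / h3 = (q nu5 +
   nu6)^2 / (q nu5 nu6)]: the product is a perfect square. The other three constants arise in the
   same way. *)
have [||sgn sgnE] := @qHeun_sign C qh p (q * nu3 * nu4 * (q * nu5 + nu6) / k2).
- by rewrite /= !mulf_neq0 ?invr_eq0.
- by rewrite /p /= nu8E -hqh; field; do ![apply/andP; split].
exists sgn => g1.
pose g t := t * g1 + nu5 / k2.
(* On the line both [q f - z] and [f - z] equal [- z], hence the excluded value 0. The multiplier is
   read off from the coefficients of [y(z/q)]. *)
apply: (@restricts_to_regular _ _ _ _ _ [:: 0]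
  (fun z t => - (nu1 * nu2 * (z - q * nu3) * (z - q * nu4) / (q * (q * t - z))))
  (fun z t => z * (g t * nu1 - 1) * (g t * nu2 - 1) / (q * g t)
    - nu1 * nu2 * nu3 * nu4 * g1 * (g t - nu6 / k2) / g t
    + nu1 * nu2 * (z - q * nu3) * (z - q * nu4) / (q * (q * t - z)) * g t
    + (z - k1 / nu7) * (z - k1 / nu8) / (q * (t - z)) / g t)
  (fun z t => - ((z - k1 / nu7) * (z - k1 / nu8) / (q * (t - z))))
  (fun z t => g t * (q * t - z) * (t - z))
  (fun z => nu1 * nu2 / (q * z))) => [z|z t|z]; rewrite !inE => z0.
- by rewrite /g; split; first [cont0_tac | idtac];
    rewrite ?(mulr0, mul0r, add0r, sub0r) !mulf_neq0 ?oppr_eq0 ?invr_eq0.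
- rewrite !mulf_eq0 !negb_or -andbA => t0 /and3P[gt qtz tz].
  rewrite /coefm /Defs.coef0 /Defs.coefp /L /L1 -/(g t); split; [ring| |ring].
  (* The factor [g - nu5 / k2 = t * g1] cancels the pole [1 / f]; nothing else about [g t] matters
     except that it is nonzero. *)
  have -> : nu5 / k2 = g t - t * g1 by rewrite /g; ring.
  by move: (g t) gt => G G0; field; do ![apply/andP; split].
- split=> [|ym y0 yp]; first by rewrite !mulf_neq0 ?invr_eq0 ?mulf_neq0.
  rewrite sgnE /p /= /g nu8E -hqh.
  by field; do ![apply/andP; split].
Qed.

Lemma restricts_to_P1 : exists sgn : bool, forall g1 : C,
  restricts_to q
    (fun f1 z ym y0 yp => L (1 / f1) (f1 * g1 + 1 / nu1) z ym y0 yp / f1)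
    (fun=> 1)
    (qHeun qh
      {| h1 := qh * nu3; h2 := qh * nu4; h3 := nu6 / nu5;
         l1 := qh * k1 / nu7; l2 := qh * k1 / nu8;
         l3 := 1 / nu1; l4 := q / nu2 |}
      (q * g1 * (1 - nu1 / nu2)
       - q / nu1 * (nu3 + nu4)
       - q * k1 / nu2 * (1 / nu7 + 1 / nu8))
      sgn).
Proof.
set p := QHeunParams _ _ _ _ _ _ _.
have [||sgn sgnE] := @qHeun_sign C qh p (q ^+ 2 * nu3 * nu4 * (nu5 + nu6) / k2).
- by rewrite /= !mulf_neq0 ?invr_eq0.
- by rewrite /p /= nu8E -hqh; field; do ![apply/andP; split].
exists sgn => g1.
pose g t := t * g1 + 1 / nu1.
(* After division by [t], the denominators become [t (q / t - z) = q - z t] and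
   [t (1 / t - z) = 1 - z t], with limits [q] and 1, so no [z] is excluded. *)
apply: (@restricts_to_regular _ _ _ _ _ [::]
  (fun z t => - (nu1 * nu2 * (z - q * nu3) * (z - q * nu4) / (q * (q - z * t))))
  (fun z t => z * g1 * nu1 * (g t * nu2 - 1) / (q * g t)
    - nu1 * nu2 * nu3 * nu4 * (g t - nu5 / k2) * (g t - nu6 / k2) / g t
    + nu1 * nu2 * (z - q * nu3) * (z - q * nu4) / (q * (q - z * t)) * g t
    + (z - k1 / nu7) * (z - k1 / nu8) / (q * (1 - z * t)) / g t)
  (fun z t => - ((z - k1 / nu7) * (z - k1 / nu8) / (q * (1 - z * t))))
  (fun z t => g t * (q - z * t) * (1 - z * t))
  (fun z => - (nu1 * nu2 / q ^+ 2))) => [z _|z t _|z _].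
- by rewrite /g; split; first [cont0_tac | idtac];
    rewrite ?(mulr0, mul0r, add0r, subr0) !mulf_neq0 ?invr_eq0 ?oner_eq0.
- rewrite !mulf_eq0 !negb_or -andbA => t0 /and3P[gt qtz tz].
  rewrite /coefm /Defs.coef0 /Defs.coefp /L /L1 -/(g t).
  (* The only term without a decaying factor in [f] gets its factor [t] from here. *)
  have -> : g t * nu1 - 1 = t * g1 * nu1 by rewrite /g; field.
  by move: (g t) gt => G G0; split; field; rewrite ?mulNr; do ![apply/andP; split].
- split=> [|ym y0 yp].
    by rewrite oppr_eq0 !mulf_neq0 ?invr_eq0 ?mulf_neq0.
  rewrite sgnE /p /= /g nu8E -hqh.
  by field; do ![apply/andP; split].
Qed.

Lemma restricts_to_P7 : exists sgn : bool, forall f1 : C,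
  restricts_to q
    (fun g1 => L (f1 * g1 + k1 / nu7) g1)
    (fun z => nu7 * z - k1)
    (qHeun qh
      {| h1 := qh * nu3; h2 := qh * nu4; h3 := nu6 / nu5;
         l1 := k1 / (qh * nu7); l2 := qh * k1 / nu8;
         l3 := q / nu1; l4 := q / nu2 |}
      (q * f1 / (nu1 * nu2) * (1 - nu7 / nu8)
       - q * k1 / nu7 * (1 / nu1 + 1 / nu2)
       - q ^+ 2 * nu3 * nu4 * nu7 * (nu5 + nu6) / (k1 * k2))
      sgn).
Proof.
set p := QHeunParams _ _ _ _ _ _ _.
have [||sgn sgnE] := @qHeun_sign C qh p (q ^+ 2 * nu3 * nu4 * (nu5 + nu6) / k2).
- by rewrite /= !mulf_neq0 ?invr_eq0.
- by rewrite /p /= nu8E -hqh; field; do ![apply/andP; split].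
(* [a] is the [f]-coordinate of P7, kept opaque as an atom for [field]. *)
exists sgn => f1; have [a aE] : exists a, a = k1 / nu7 by exists (k1 / nu7).
have a0 : a != 0 by rewrite aE mulf_neq0 ?invr_eq0.
have k1E : k1 = a * nu7 by rewrite aE divfK.
pose f t := f1 * t + a.
(* Zeros on the line of [f - z] and [q f - z], and of the gauge factor at [z], [z / q] and [q z]. *)
have notinS z : z \notin [:: a; q * a; a / q] ->
    [/\ a - z != 0, q * a - z != 0 & q * z - a != 0].
  rewrite !inE !negb_or ![z == _]eq_sym => /and3P[za zqa zaq].
  rewrite !subr_eq0; split=> //.
  by apply: contraNneq zaq => <-; rewrite -[q * z / q] mulrAC mulfV // mul1r.
(* The terms in [f1] come from [1 / f = 1 / a - f1 t / (a f)] and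
   [(z - a) / (f - z) = -1 + f1 t / (f - z)]. The residues left are [k1 / (q nu8)] and
   [- nu1 nu2 nu3 nu4 nu5 nu6 / (k2^2 a)], opposite by [hrel]. *)
apply: (@restricts_to_regular _ _ _ _ _ [:: a; q * a; a / q]
  (fun z t => - (nu1 * nu2 * (z - q * nu3) * (z - q * nu4) / (q * (q * f t - z))))
  (fun z t => z * (nu1 * nu2 * t - (nu1 + nu2)) / q
    + nu1 * nu2 * nu3 * nu4 * ((nu5 + nu6) / k2 - t) / f t
    + nu1 * nu2 * nu3 * nu4 * nu5 * nu6 * f1 / (k2 * k2 * a * f t)
    + nu1 * nu2 * (z - q * nu3) * (z - q * nu4) / (q * (q * f t - z)) * t
    + (z - k1 / nu8) * f1 / (q * (f t - z)))
  (fun z t => - ((z - a) * (z - k1 / nu8) / (q * (f t - z))))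
  (fun z t => f t * (q * f t - z) * (f t - z))
  (fun z => nu1 * nu2 * nu7 / q ^+ 2)) => [z|z t|z] /notinS[za zqa zaq].
- by rewrite /f; split; first [cont0_tac | idtac];
    rewrite ?(mulr0, add0r) ?mulf_neq0 ?invr_eq0.
- rewrite !mulf_eq0 !negb_or -andbA => t0 /and3P[ft qftz ftz].
  rewrite /coefm /Defs.coef0 /Defs.coefp /L /L1 -aE -/(f t); split; [ring| |ring].
  rewrite nu8E k1E; rewrite /f in ft qftz ftz *.
  by field; do ![apply/andP; split].
- split=> [|ym y0 yp].
    by rewrite !mulf_neq0 ?invr_eq0 ?mulf_neq0.
  (* This is proportional to the denominator of the [y(z/q)] coefficient, so the multiplier is
     constant in [z]. *)
  have -> : nu7 * (z / q) - k1 = - (nu7 / q * (q * a - z)).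
    by rewrite k1E; field.
  have -> : nu7 * z - k1 = - (nu7 * (a - z)) by rewrite k1E; ring.
  have -> : nu7 * (q * z) - k1 = nu7 * (q * z - a) by rewrite k1E; ring.
  rewrite sgnE /p /= /f nu8E k1E mulr0 add0r.
  rewrite -hqh in za zqa zaq *.
  by field; do ![apply/andP; split].
Qed.

Lemma restricts_to_P3 : exists sgn : bool, forall f1 : C,
  restricts_to q
    (fun g1 => L (f1 * g1 + nu3) (1 / g1))
    (fun z => z - q * nu3)
    (qHeun qh
      {| h1 := qh ^+ 3 * nu3; h2 := qh * nu4; h3 := nu6 / nu5;
         l1 := qh * k1 / nu7; l2 := qh * k1 / nu8;
         l3 := q / nu1; l4 := q / nu2 |}
      (q ^+ 2 * (f1 * (1 - nu4 / nu3)
                 - nu3 * (1 / nu1 + 1 / nu2)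
                 - nu4 / k2 * (nu5 + nu6)))
      sgn).
Proof.
set p := QHeunParams _ _ _ _ _ _ _.
have [||sgn sgnE] := @qHeun_sign C qh p (q ^+ 3 * nu3 * nu4 * (nu5 + nu6) / k2).
- by rewrite /= !mulf_neq0 ?invr_eq0.
- by rewrite /p /= nu8E -hqh; field; do ![apply/andP; split].
exists sgn => f1; pose f t := f1 * t + nu3.
have notinS z : z \notin [:: nu3; q * nu3; q * (q * nu3)] ->
    [/\ nu3 - z != 0, q * nu3 - z != 0 & q * (q * nu3) - z != 0].
  by rewrite !inE !negb_or ![z == _]eq_sym !subr_eq0 => /and3P.
(* Here the expansions are [nu3 / f = 1 - f1 t / f] and [(z - q nu3) / (q f - z) = -1 + q f1 t / (q
   f - z)]; the residues [nu1 nu2 z / q], [- nu1 nu2 nu4] and [- nu1 nu2 (z - q nu4) / q] add up to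
   0. *)
apply: (@restricts_to_regular _ _ _ _ _ [:: nu3; q * nu3; q * (q * nu3)]
  (fun z t => - (nu1 * nu2 * (z - q * nu3) * (z - q * nu4) / (q * (q * f t - z))))
  (fun z t => z * (t - (nu1 + nu2)) / q
    + nu1 * nu2 * nu3 * nu4 * ((nu5 + nu6) / k2 - t * nu5 * nu6 / (k2 * k2)) / f t
    + nu1 * nu2 * nu4 * f1 / f t
    + nu1 * nu2 * (z - q * nu4) * f1 / (q * f t - z)
    + (z - k1 / nu7) * (z - k1 / nu8) / (q * (f t - z)) * t)
  (fun z t => - ((z - k1 / nu7) * (z - k1 / nu8) / (q * (f t - z))))
  (fun z t => f t * (q * f t - z) * (f t - z))
  (fun z => nu1 * nu2 / q ^+ 2)) => [z|z t|z] /notinS[z1 z2 z3].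
- by rewrite /f; split; first [cont0_tac | idtac];
    rewrite ?(mulr0, add0r) ?mulf_neq0 ?invr_eq0.
- rewrite !mulf_eq0 !negb_or -andbA => t0 /and3P[ft qftz ftz].
  rewrite /coefm /Defs.coef0 /Defs.coefp /L /L1 -/(f t); split; [ring| |ring].
  rewrite /f in ft qftz ftz *.
  by field; do ![apply/andP; split].
- split=> [|ym y0 yp].
    by rewrite !mulf_neq0 ?invr_eq0 ?mulf_neq0.
  (* The gauge trades the factor [z - q nu3], cancelled on the line, for [z - q^2 nu3]; this is the
     extra [q] in [h1]. *)
  have -> : z / q - q * nu3 = - ((q * (q * nu3) - z) / q) by field.
  have -> : z - q * nu3 = - (q * nu3 - z) by ring.
  have -> : q * z - q * nu3 = - (q * (nu3 - z)) by ring.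
  rewrite sgnE /p /= /f nu8E mulr0 add0r.
  rewrite -hqh in z2 z3 *.
  by field; do ![apply/andP; split].
Qed.
End ExceptionalLines.

Theorem mainTheorem1 (R : realType)
    (q qh k1 k2 nu1 nu2 nu3 nu4 nu5 nu6 nu7 nu8 : R[i])
    (hq : q != 0) (hk1 : k1 != 0) (hk2 : k2 != 0)
    (hnu1 : nu1 != 0) (hnu2 : nu2 != 0) (hnu3 : nu3 != 0) (hnu4 : nu4 != 0)
    (hnu5 : nu5 != 0) (hnu6 : nu6 != 0) (hnu7 : nu7 != 0) (hnu8 : nu8 != 0)
    (hrel : k1 ^+ 2 * k2 ^+ 2
            = q * (nu1 * nu2 * nu3 * nu4 * nu5 * nu6 * nu7 * nu8))
    (hqh : qh ^+ 2 = q) :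
  let L := L1 q k1 k2 nu1 nu2 nu3 nu4 nu5 nu6 nu7 nu8 in
  [/\ (* P5, P6 *)
      forall m5 m6 : R[i], (m5, m6) \in [:: (nu5, nu6); (nu6, nu5)] ->
      exists sgn : bool, forall g1 : R[i],
      restricts_to q
        (fun f1 => L f1 (f1 * g1 + m5 / k2))
        (fun=> 1)
        (qHeun qh
          {| h1 := qh * nu3; h2 := qh * nu4; h3 := q * m5 / m6;
             l1 := qh * k1 / nu7; l2 := qh * k1 / nu8;
             l3 := 1 / nu1; l4 := 1 / nu2 |}
          (q * g1 * nu3 * nu4 * (1 - m6 / m5)
           - q * m5 * (nu3 + nu4) / k2
           - k1 * k2 * (nu7 + nu8) / (nu1 * nu2 * m5 * nu7 * nu8))
          sgn),
      (* P7, P8 *)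
      forall m7 m8 : R[i], (m7, m8) \in [:: (nu7, nu8); (nu8, nu7)] ->
      exists sgn : bool, forall f1 : R[i],
      restricts_to q
        (fun g1 => L (f1 * g1 + k1 / m7) g1)
        (fun z => m7 * z - k1)
        (qHeun qh
          {| h1 := qh * nu3; h2 := qh * nu4; h3 := nu6 / nu5;
             l1 := k1 / (qh * m7); l2 := qh * k1 / m8;
             l3 := q / nu1; l4 := q / nu2 |}
          (q * f1 / (nu1 * nu2) * (1 - m7 / m8)
           - q * k1 / m7 * (1 / nu1 + 1 / nu2)
           - q ^+ 2 * nu3 * nu4 * m7 * (nu5 + nu6) / (k1 * k2))
          sgn),
      (* P1, P2 *)
      forall m1 m2 : R[i], (m1, m2) \in [:: (nu1, nu2); (nu2, nu1)] ->
      exists sgn : bool, forall g1 : R[i],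
      restricts_to q
        (fun f1 z ym y0 yp => L (1 / f1) (f1 * g1 + 1 / m1) z ym y0 yp / f1)
        (fun=> 1)
        (qHeun qh
          {| h1 := qh * nu3; h2 := qh * nu4; h3 := nu6 / nu5;
             l1 := qh * k1 / nu7; l2 := qh * k1 / nu8;
             l3 := 1 / m1; l4 := q / m2 |}
          (q * g1 * (1 - m1 / m2)
           - q / m1 * (nu3 + nu4)
           - q * k1 / m2 * (1 / nu7 + 1 / nu8))
          sgn)
    & (* P3, P4 *)
      forall m3 m4 : R[i], (m3, m4) \in [:: (nu3, nu4); (nu4, nu3)] ->
      exists sgn : bool, forall f1 : R[i],
      restricts_to q
        (fun g1 => L (f1 * g1 + m3) (1 / g1))
        (fun z => z - q * m3)
        (qHeun qh
          {| h1 := qh ^+ 3 * m3; h2 := qh * m4; h3 := nu6 / nu5;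
             l1 := qh * k1 / nu7; l2 := qh * k1 / nu8;
             l3 := q / nu1; l4 := q / nu2 |}
          (q ^+ 2 * (f1 * (1 - m4 / m3)
                     - m3 * (1 / nu1 + 1 / nu2)
                     - m4 / k2 * (nu5 + nu6)))
          sgn)].
Proof.
move=> L; split=> [m5 m6|m7 m8|m1 m2|m3 m4];
  rewrite !inE => /orP[] /eqP[-> ->].
- exact: restricts_to_P5.
(* The relation [hrel] is invariant under the exchange as well. *)
- by rewrite /L -L1_swap56; apply: restricts_to_P5 => //; rewrite hrel; ring.
- exact: restricts_to_P7.
- by rewrite /L -L1_swap78; apply: restricts_to_P7 => //; rewrite hrel; ring.
- exact: restricts_to_P1.
- by rewrite /L -L1_swap12; apply: restricts_to_P1 => //; rewrite hrel; ring.
- exact: restricts_to_P3.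
- by rewrite /L -L1_swap34; apply: restricts_to_P3 => //; rewrite hrel; ring.
Qed.
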